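(* Let $\mathcal{G}$ be a second countable, Hausdorff, locally compact, totally disconnected topological group and let $T:\mathcal{G}\to\mathcal{G}$ be a continuous group automorphism. If $T$ is (topologically) transitive, then $(\mathcal{G},T)$ is topologically conjugate to $(\Sigma_{\mathcal{G}},\sigma_{\mathcal{G}})$, where $\Sigma_{\mathcal{G}}$ is an inverse limit of full-shifts on finite alphabets and $\sigma_{\mathcal{G}}$ is the map induced by the shift transformation on every level.
   Context: The full-shift on a finite alphabet $A$ is $A^{\mathbb{Z}}$ (product topology, $A$ discrete) with the shift $\sigma(x)_i=x_{i+1}$. The inverse limit is that of a sequence of full-shifts indexed by $\mathbb{N}$ with bonding maps that are continuous surjections commuting with the shifts. A topological conjugacy is a homeomorphism intertwining the two maps. *)

(* Defs.v *)
From HB Require Import structures.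
From mathcomp Require Import all_boot all_order all_algebra.
From mathcomp Require Import boolp classical_sets functions topology.

Set Implicit Arguments.
Unset Strict Implicit.
Unset Printing Implicit Defensive.

Local Open Scope classical_set_scope.

(* Not assumed abelian, hence not TopologicalZmodule from tvs.v. *)
HB.mixin Record Topological_isTopologicalGroup G
    of Topological G & Group G := {
  mulg_continuous : continuous (fun p : G * G => (p.1 * p.2)%g) ;
  invg_continuous : continuous (fun x : G => x^-1%g)
}.

#[short(type="topologicalGroupType")]
HB.structure Definition TopologicalGroup :=
  {G of Topological G & Group G & Topological_isTopologicalGroup G}.

Definition topologically_transitive (X : topologicalType) (T : X -> X) : Prop :=
  forall U V : set X, open U -> open V -> U !=set0 -> V !=set0 ->
    exists n : nat, (iter n T @` U) `&` V !=set0.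

Definition homeomorphism (X Y : topologicalType) (h : X -> Y) : Prop :=
  exists g : Y -> X,
    [/\ cancel h g, cancel g h, continuous h & continuous g].

Definition topologically_conjugate (X Y : topologicalType)
    (S : X -> X) (T : Y -> Y) : Prop :=
  exists2 h : X -> Y, homeomorphism h & h \o S =1 T \o h.

(* A may be empty; then so is the full shift. A limit conjugate to a group is
   inhabited, which rules this out. *)
Definition full_shift (A : finType) : topologicalType :=
  prod_topology (fun _ : int => discrete_topology A).

Definition shift (A : finType) (x : full_shift A) : full_shift A :=
  fun i : int => x (i + 1)%R.

Definition inverse_limit_set (X : nat -> topologicalType)
    (f : forall n, X n.+1 -> X n) : set (prod_topology X) :=
  [set x | forall n, f n (x n.+1) = x n].

(* set_type carries the subspace topology inherited from the product. *)
Definition inverse_limit (X : nat -> topologicalType)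
    (f : forall n, X n.+1 -> X n) : topologicalType :=
  set_type (inverse_limit_set f).

Section induced_map.
Variables (X : nat -> topologicalType) (f : forall n, X n.+1 -> X n).
Variables (s : forall n, X n -> X n).
Hypothesis fs : forall n x, f (s x) = s (f x) :> X n.

Fact inverse_limit_map_subproof (x : inverse_limit f) :
  (fun n => s (set_val x n)) \in inverse_limit_set f.
Proof. by apply/mem_set => n; rewrite fs (set_mem (valP x) n). Qed.

Definition inverse_limit_map (x : inverse_limit f) : inverse_limit f :=
  exist _ (fun n => s (set_val x n)) (inverse_limit_map_subproof x).

End induced_map.

Record full_shift_system := FullShiftSystem {
  alphabet : nat -> finType ;
  bond : forall n, full_shift (alphabet n.+1) -> full_shift (alphabet n) ;
  bond_continuous : forall n, continuous (@bond n) ;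
  bond_surjective : forall n y, exists x, @bond n x = y ;
  bond_shift : forall n x, bond (shift x) = shift (@bond n x)
}.

Definition shift_limit (S : full_shift_system) : topologicalType :=
  inverse_limit (@bond S).

Definition shift_limit_map (S : full_shift_system) :
    shift_limit S -> shift_limit S :=
  @inverse_limit_map (fun n => full_shift (alphabet S n)) (@bond S)
    (fun n => @shift (alphabet S n)) (@bond_shift S).

(* Main.v *)
Require Import Defs.
From mathcomp Require Import all_boot all_order all_algebra.
From mathcomp Require Import boolp classical_sets functions topology.
From mathcomp Require Import finmap cardinality zify.

Set Implicit Arguments.
Unset Strict Implicit.
Unset Printing Implicit Defensive.

Local Open Scope classical_set_scope.

(* Compactness. In a compact open subgroup [V] that is tidy above, i.e.
   [V = V_+ V_-] with [V_+ = \bigcap_(k >= 0) T^k V] and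
   [V_- = \bigcap_(k >= 0) T^-k V], transitivity writes every point of
   [T V_+] as [d w] with [w] in [V_+] and [T^k d] in [V] for all [k >= N], where
   [N] is uniform by compactness of [T V_+]. Iterating,
   [T^n V_+ <= V (T^N V_+)] for all [n], and transitivity once more gives
   [G = V (T^N V) V].

   Coding. For [V] open, normal and tidy above in the compact group [G], the
   subgroups [P_j = T^-j V . V] increase to [G = P_m]. There is a choice [f] of
   successors, [f x] in [T x . TV . V], sending cosets of [P_(j+1)] into cosets
   of [P_j]. The label of [x] is the class of [(f x)^-1 (T x)] in the finite
   group [TV . V / V]. Points with the same [m] last labels agree modulo
   [P_0 = V], so the itinerary map is onto a full shift, and its fibres are the
   cosets of [\bigcap_(k in Z) T^k V]. A decreasing sequence of open normal
   subgroups with trivial intersection then yields the inverse limit. *)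

(** * Compactness arguments and small compact open sets *)

Section Compactness.
Variable X : topologicalType.

(** Otherwise the sets (K [&] A) [\] O form a proper filter base; a cluster point in [K] lies in
    every closed [A], hence in [O], which these sets avoid. *)
Lemma compact_bigcap_sub (D : set (set X)) (K O : set X) :
    D !=set0 ->
    (forall A B, D A -> D B -> exists2 C, D C & C `<=` A `&` B) ->
    (forall A, D A -> closed A) -> compact K -> open O ->
    (forall x, K x -> (forall A, D A -> A x) -> O x) ->
  exists2 A, D A & K `&` A `<=` O.
Proof.
move=> [A0 DA0] DI Dcl cK oO KO; apply: contrapT => nA.
pose F := filter_from D (fun A => (K `&` A) `\` O).
have FF : Filter F.
  apply: filter_from_filter; first by exists A0.
  move=> A B DA DB; have [C DC CAB] := DI A B DA DB.
  by exists C => // x [[Kx /CAB[Ax Bx]] nOx].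
have PF : ProperFilter F.
  apply: filter_from_proper => A DA; apply: contrapT => nKA.
  apply: nA; exists A => // x KAx; apply: contrapT => nOx.
  by apply: nKA; exists x.
have FK : F K by exists A0 => // x [[]].
have [x [Kx clx]] := cK F PF FK.
have FD A : D A -> F ((K `&` A) `\` O) by exists A.
have Ox : O x.
  apply: KO => // A DA; apply: (Dcl _ DA) => U Ux.
  by have [y [[[_ Ay] _] Uy]] := clx _ _ (FD _ DA) Ux; exists y.
have [y [[_ nOy] Oy]] := clx _ O (FD _ DA0) (open_nbhs_nbhs (conj oO Ox)).
exact: nOy.
Qed.

Lemma compact_bigcap_nat_sub (C : nat -> set X) (K O : set X) :
    (forall m n, m <= n -> C n `<=` C m) -> (forall n, closed (C n)) ->
    compact K -> open O ->
    (forall x, K x -> (forall n, C n x) -> O x) ->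
  exists n, K `&` C n `<=` O.
Proof.
move=> Cdecr Ccl cK oO KO.
have [||||||_ [n _ <-] KC] := @compact_bigcap_sub (range C) K O.
- by exists (C 0); exists 0.
- move=> _ _ [m _ <-] [n _ <-]; exists (C (maxn m n)); first by exists (maxn m n).
  by move=> x Cx; split; apply: Cdecr Cx; rewrite (leq_maxl, leq_maxr).
- by move=> _ [n _ <-].
- by [].
- by [].
- by move=> x Kx Cx; apply: KO => // n; apply: Cx; exists n.
by exists n.
Qed.

Lemma compact_bigcap_nat_nonempty (C : nat -> set X) (K : set X) :
    (forall m n, m <= n -> C n `<=` C m) -> (forall n, closed (C n)) ->
    compact K -> (forall n, K `&` C n !=set0) ->
  exists2 x, K x & forall n, C n x.
Proof.
move=> Cdecr Ccl cK KC; apply: contrapT => nx.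
have [|n KC0] := compact_bigcap_nat_sub Cdecr Ccl cK (@open0 X).
  by move=> x Kx Cx; apply: nx; exists x.
by have [x /KC0] := KC n.
Qed.

Lemma compact_cover_nat (U : nat -> set X) (K : set X) :
    (forall m n, m <= n -> U m `<=` U n) -> (forall n, open (U n)) ->
    compact K -> (forall x, K x -> exists n, U n x) ->
  exists n, K `<=` U n.
Proof.
move=> Uincr Uop cK KU; have [|||n KCn] :=
  @compact_bigcap_nat_sub (fun n => ~` U n) K set0 _ _ cK (@open0 X).
- by move=> m n mn; apply: subsetC; apply: Uincr.
- by move=> n; apply: open_closedC.
- by move=> x /KU[n Unx] /(_ n).
by exists n => x Kx; apply: contrapT => nUx; apply: (KCn x).
Qed.

(* The quasi-component of [x] in a compact neighbourhood is connected, hence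
   reduced to [x]. *)
Lemma totally_disconnected_compact_open_nbhs (x : X) (K W : set X) :
    hausdorff_space X -> totally_disconnected [set: X] ->
    compact K -> nbhs x K -> nbhs x W ->
  exists U, [/\ open U, compact U, U x & U `<=` W].
Proof.
move=> hX tdX cK Kx Wx.
have [V Vx VKW] : filter_from (nbhs x) closure (K° `&` W).
  by apply: (compact_regular hX cK Kx); apply: filterI => //; apply: nbhs_interior.
set C := closure V in VKW.
have VC : V `<=` C by exact: subset_closure.
have clC : closed C by exact: closed_closure.
have CK : C `<=` K by move=> y /VKW[/interior_subset].
have cC : compact C by exact: subclosed_compact clC cK CK.
(* The relatively clopen subsets of [C] containing [x]; their intersection [Q] is the
   quasi-component. *)
pose D := [set A | [/\ closed A, A x & exists2 B, open B & A = C `&` B]].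
have DI A B : D A -> D B -> D (A `&` B).
  move=> [clA Ax [A' oA' AE]] [clB Bx [B' oB' BE]]; split => //.
    exact: closedI.
  by exists (A' `&` B'); [exact: openI | rewrite AE BE setIACA setIid].
have DC : D C.
  split=> //; first by apply: VC; exact: nbhs_singleton.
  by exists setT; rewrite ?setIT//; exact: openT.
have Dcap O : open O -> (forall y, (forall A, D A -> A y) -> O y) ->
    exists2 A, D A & A `<=` O.
  move=> oO KO; have [||||||A DA CAO] := @compact_bigcap_sub D C O.
  - by exists C.
  - by move=> A B DA DB; exists (A `&` B) => //; exact: DI.
  - by move=> A [].
  - by [].
  - by [].
  - by move=> y _; apply: KO.
  exists A => // y Ay; apply: CAO; split => //.
  by case: DA Ay => _ _ [B _ ->] [].
pose Q := [set y | forall A, D A -> A y].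
have clQ : closed Q.
  rewrite (_ : Q = \bigcap_(A in D) A); last by [].
  by apply: closed_bigI => A [].
have Qx : Q x by move=> A [].
have QC : Q `<=` C by move=> y /(_ _ DC).
have Qsplit P1 P2 : closed P1 -> closed P2 -> P1 `|` P2 = Q ->
    P1 `&` P2 = set0 -> P1 x -> P2 = set0.
  move=> cl1 cl2 P12 P120 P1x.
  have P1K : P1 `<=` K°.
    by move=> y P1y; have [] : (K° `&` W) y by apply/VKW/QC; rewrite -P12; left.
  (* Normality separates the two closed pieces of [Q]. Some [A] in [D] avoids the boundary of [N']
     inside [closure N], so [A] cut by [N'] is again in [D] and misses [P2]. *)
  have [N nN NP2] : filter_from (set_nbhs P1) closure (~` P2).
    apply: (compact_normal_local hX cK P1K cl1).
    apply/set_nbhsP; exists (~` P2); split => //; first exact: closed_openC.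
    by apply/disjoints_subset.
  have [N' [oN' P1N' N'N]] := (set_nbhsP _ _).1 nN.
  have N'cl : N' `<=` closure N by move=> y /N'N; exact: subset_closure.
  have [||A [clA Ax [B oB AE]] AN] := Dcap (N' `|` ~` closure N).
  - by apply: openU => //; exact/closed_openC/closed_closure.
  - move=> y Qy; have : (P1 `|` P2) y by rewrite P12.
    by case=> [/P1N'|P2y]; [left|right => /NP2].
  have DA' : D (A `&` N').
    split; last by exists (B `&` N'); [exact: openI|rewrite AE setIA].
      suff -> : A `&` N' = A `&` closure N.
        by apply: closedI => //; exact: closed_closure.
      apply/seteqP; split => y [Ay Ny]; split => //; first exact: N'cl.
      by case: (AN _ Ay).
    by split=> //; exact: P1N'.
  rewrite -subset0 => y P2y; have Qy : Q y by rewrite -P12; right.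
  by have [_ /N'cl/NP2] := Qy _ DA'.
have cQ : connected Q.
  move=> B B0 [O oO BO] [E clE BE].
  have clB : closed B by rewrite BE; exact: closedI.
  have clB' : closed (Q `\` B).
    rewrite BO setDIr setDv set0U; apply: closedI => //; exact: open_closedC.
  have BQ : B `<=` Q by rewrite BO => y [].
  have BU : B `|` (Q `\` B) = Q by rewrite setUC setDKU.
  have BI : B `&` (Q `\` B) = set0 by rewrite setIC setDKI.
  have [Bx|nBx] := pselect (B x).
    have := Qsplit _ _ clB clB' BU BI Bx.
    by rewrite setD_eq0 => QB; apply/seteqP.
  have := Qsplit _ _ clB' clB; rewrite setUC setIC => /(_ BU BI).
  by case: B0 => y By => /(_ (conj Qx nBx)) B0; rewrite B0 in By.
have Q1 : Q `<=` [set x].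
  by rewrite -(tdX x I); apply: connected_component_max => //.
(* A member of [D] inside the interior of [V] is open in [X], because it is the trace of an open set
   there. *)
have [||A DA AV] := Dcap V°.
- exact: open_interior.
- by move=> y /Q1 ->; exact: Vx.
case: DA => clA Ax [B oB AE].
have AC : A `<=` C by rewrite AE => y [].
exists A; split => //.
- suff -> : A = V° `&` B by apply: openI => //; exact: open_interior.
  apply/seteqP; split=> y.
    by move=> Ay; split; [exact: AV|by move: Ay; rewrite AE => -[]].
  by move=> [Vy By]; rewrite AE; split => //; apply: VC; exact: interior_subset.
- exact: subclosed_compact clA cC AC.
- by move=> y /AC/VKW[].
Qed.

(** The complement of the preimage of an open set under [g] is the image under [f] of a compact set,
    hence closed. *)
Lemma compact_surj_continuous (Y Z : topologicalType) (f : X -> Y) (g : Y -> Z) :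
    compact [set: X] -> hausdorff_space Y -> continuous f ->
    (forall y, exists x, f x = y) -> continuous (g \o f) ->
  continuous g.
Proof.
move=> cX hY cf fsurj cgf; apply/continuousP => A oA.
rewrite -[_ @^-1` _]setCK; apply: closed_openC.
have -> : ~` (g @^-1` A) = f @` (~` ((g \o f) @^-1` A)).
  apply/seteqP; split => y; first by have [x <-] := fsurj y => nA; exists x.
  by move=> [x nA <-].
apply: (compact_closed hY); apply: continuous_compact.
  exact: continuous_subspaceT.
apply: (@subclosed_compact _ _ setT) => //; apply: open_closedC.
by move/continuousP : cgf; exact.
Qed.

Lemma injective_continuous_hausdorff (Y : topologicalType) (f : X -> Y) :
  injective f -> continuous f -> hausdorff_space Y -> hausdorff_space X.
Proof.
move=> finj cf hY p q pq; apply/finj/hY => A B /cf fA /cf fB.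
by have [x [Ax Bx]] := pq _ _ fA fB; exists (f x).
Qed.

End Compactness.

(** * Integer iterates of a bijection *)

Definition ziter (X : Type) (f g : X -> X) (i : int) : X -> X :=
  match i with Posz n => iter n f | Negz n => iter n.+1 g end.

Section Ziter.
Variables (X : Type) (f g : X -> X).
Hypotheses (fK : cancel f g) (gK : cancel g f).

Lemma ziterS i x : ziter f g (i + 1)%R x = f (ziter f g i x).
Proof.
case: i => [n|[|n]]; first by rewrite -PoszD addn1.
  by rewrite /= gK.
have -> : (Negz n.+1 + 1 = Negz n)%R by lia.
by rewrite /= gK.
Qed.

Lemma ziterB1 i x : ziter f g (i - 1)%R x = g (ziter f g i x).
Proof. by rewrite -{2}(GRing.subrK 1%R i) ziterS fK. Qed.

Lemma ziterD i j x : ziter f g (i + j)%R x = ziter f g i (ziter f g j x).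
Proof.
elim: i => [|n IH|n IH]; first by rewrite GRing.add0r.
  have -> : (n.+1%:Z + j = n%:Z + j + 1)%R by lia.
  by rewrite ziterS IH.
have -> : (- n.+1%:Z + j = - n%:Z + j - 1)%R by lia.
have -> : (- n.+1%:Z = - n%:Z - 1)%R by lia.
by rewrite !ziterB1 IH.
Qed.

Lemma ziterK i : cancel (ziter f g i) (ziter f g (- i)%R).
Proof. by move=> x; rewrite -ziterD GRing.addNr. Qed.

Lemma ziterNK i : cancel (ziter f g (- i)%R) (ziter f g i).
Proof. by move=> x; rewrite -ziterD GRing.addrN. Qed.

Lemma ziter_fun i x : ziter f g i (f x) = f (ziter f g i x).
Proof. by rewrite -[f x]/(ziter f g 1%R x) -ziterD ziterS. Qed.

End Ziter.

Lemma ziter_nat_continuous (X : topologicalType) (f g : X -> X) (n : nat) :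
  continuous f -> continuous (ziter f g n).
Proof.
move=> cf; elim: n => [x|n IH x]; first exact: cvg_id.
exact: (continuous_comp (IH x) (cf _)).
Qed.

Lemma ziter_continuous (X : topologicalType) (f g : X -> X) i :
  continuous f -> continuous g -> continuous (ziter f g i).
Proof.
move=> cf cg; case: i => n; first exact: ziter_nat_continuous.
exact: (@ziter_nat_continuous _ g f n.+1).
Qed.

(** * Cosets, and open subgroups of topological groups *)

Section Subgroups.
Variable G : groupType.
Local Open Scope group_scope.

Definition is_subgroup (H : set G) : Prop :=
  [/\ H 1, forall x y, H x -> H y -> H (x * y) & forall x, H x -> H x^-1].

Definition is_normal (H : set G) : Prop := forall g x, H x -> H (x ^ g).

Section Cosets.
Variable H : set G.
Hypothesis sgH : is_subgroup H.

Lemma sgrp1 : H 1. Proof. by case: sgH. Qed.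
Lemma sgrpM x y : H x -> H y -> H (x * y). Proof. by case: sgH => _ + _; apply. Qed.
Lemma sgrpV x : H x -> H x^-1. Proof. by case: sgH => _ _; apply. Qed.

Lemma cosetxx x : H (x^-1 * x).
Proof. by rewrite mulVg; exact: sgrp1. Qed.

Lemma coset_sym x y : H (x^-1 * y) -> H (y^-1 * x).
Proof. by move/sgrpV; rewrite invgM invgK. Qed.

Lemma coset_trans y x z : H (x^-1 * y) -> H (y^-1 * z) -> H (x^-1 * z).
Proof. by move=> /sgrpM h /h; rewrite mulgA mulgK. Qed.

Lemma cosetMM x y x' y' : is_normal H ->
  H (x^-1 * y) -> H (x'^-1 * y') -> H ((x * x')^-1 * (y * y')).
Proof.
move=> nH Hxy Hxy'; have -> : (x * x')^-1 * (y * y') =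
    (x^-1 * y) ^ x' * (x'^-1 * y') by rewrite conjgE !gnorm.
by apply: sgrpM => //; apply: nH.
Qed.

End Cosets.

(** Stands for the left coset xH without forming a quotient: [xget] depends only on the set it is
    given, so congruent elements get equal representatives. *)
Definition coset_repr (H : set G) (x : G) : G := xget 1 [set y | H (x^-1 * y)].

Lemma coset_reprP H x : is_subgroup H -> H (x^-1 * coset_repr H x).
Proof. by move=> sgH; apply: (@xgetI _ 1 [set y | H (x^-1 * y)] x); exact: cosetxx. Qed.

Lemma eq_coset_repr H x y : is_subgroup H ->
  H (x^-1 * y) -> coset_repr H x = coset_repr H y.
Proof.
move=> sgH Hxy; congr xget; apply/seteqP; split => z /= Hz.
  exact: coset_trans (coset_sym sgH Hxy) Hz.
exact: coset_trans Hxy Hz.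
Qed.

End Subgroups.

Section TopologicalGroups.
Variable G : topologicalGroupType.
Local Open Scope group_scope.
Implicit Types K H : set G.

Lemma mulgl_continuous (a : G) : continuous (fun x : G => a * x).
Proof.
move=> x; apply: (@continuous_comp _ _ _ (fun x : G => (a, x))
  (fun p : G * G => p.1 * p.2)).
  by apply: cvg_pair; [exact: cvg_cst|exact: cvg_id].
exact: mulg_continuous.
Qed.

Lemma mulgr_continuous (a : G) : continuous (fun x : G => x * a).
Proof.
move=> x; apply: (@continuous_comp _ _ _ (fun x : G => (x, a))
  (fun p : G * G => p.1 * p.2)).
  by apply: cvg_pair; [exact: cvg_id|exact: cvg_cst].
exact: mulg_continuous.
Qed.

Lemma open_coset H a : open H -> open [set x | H (a^-1 * x)].
Proof. by move=> oH; apply: (open_comp _ oH) => x _; exact: mulgl_continuous. Qed.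

Lemma open_subgroup_closed H : is_subgroup H -> open H -> closed H.
Proof.
move=> sgH oH; rewrite -[H]setCK; apply: open_closedC.
rewrite openE => x nHx; rewrite /interior nbhsE.
exists [set y | H (x^-1 * y)]; first by split; [exact: open_coset|exact: cosetxx].
move=> y /= /(coset_sym sgH) Hyx Hy; apply: nHx.
by rewrite -(mulVKg y x); exact: sgrpM.
Qed.

Lemma subgroup_nbhs1_open H : is_subgroup H -> nbhs 1 H -> open H.
Proof.
move=> sgH H1; rewrite openE => x Hx; rewrite /interior.
have : nbhs x [set y | H (x^-1 * y)].
  by apply: mulgl_continuous; rewrite mulVg.
by apply: filterS => y /= Hxy; rewrite -(mulVKg x y); exact: sgrpM.
Qed.

Lemma mulg_cvg (I : Type) (F : set_system I) (FF : Filter F) (u v : I -> G) a b :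
  u @ F --> a -> v @ F --> b -> (fun i => u i * v i) @ F --> a * b.
Proof.
move=> ua vb.
exact: (@continuous2_cvg I G G G F FF u v (fun x y => x * y) a b
  (@mulg_continuous G (a, b)) ua vb).
Qed.

(** [R] consists of the g with Cg inside C. The tube lemma makes it a neighbourhood of 1, so its
    symmetric part is an open subgroup, inside [C] because 1 is in [C]. *)
Lemma compact_open_subgroup_sub (C : set G) : compact C -> open C -> C 1 ->
  exists K, [/\ is_subgroup K, open K, compact K & K `<=` C].
Proof.
move=> cC oC C1; pose R := [set g | forall c, C c -> C (c * g)].
have R1 : nbhs 1 R.
  have /compact_near_coveringP/(_ G (nbhs 1) (fun g c => C (c * g))) := cC.
  apply => c Cc; apply: (mulg_continuous (c, 1)).
  by apply: open_nbhs_nbhs; split; rewrite //= mulg1.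
pose K := R `&` [set g | R g^-1].
have KC : K `<=` C by move=> g [/(_ 1 C1) + _]; rewrite mul1g.
have sgK : is_subgroup K.
  split=> [|x y [Rx Rx'] [Ry Ry']|x [Rx Rx']].
  - by split=> c Cc; rewrite ?invg1 mulg1.
  - by split=> c Cc; rewrite ?invgM mulgA; [apply/Ry/Rx|apply/Rx'/Ry'].
  - by split; rewrite //= invgK.
have oK : open K.
  apply: subgroup_nbhs1_open => //; apply: filterI => //.
  by apply: invg_continuous; rewrite invg1.
exists K; split => //.
exact: subclosed_compact (open_subgroup_closed sgK oK) cC KC.
Qed.

(** The intersection of all conjugates of [K] contains a neighbourhood of 1, by the tube lemma over
    the compact set of conjugating elements. *)
Lemma open_normal_core K : compact [set: G] -> is_subgroup K -> open K ->
  exists N, [/\ is_subgroup N, is_normal N, open N & N `<=` K].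
Proof.
move=> cG sgK oK; pose N := [set x | forall g, K (x ^ g)].
have sgN : is_subgroup N.
  split=> [g|x y Nx Ny g|x Nx g].
  - by rewrite conj1g; exact: sgrp1.
  - by rewrite conjMg; exact: sgrpM.
  - by rewrite conjVg; exact: sgrpV.
exists N; split => //; first by move=> g x Nx h; rewrite -conjgM.
- apply: subgroup_nbhs1_open => //.
  have N1 : nbhs 1 [set x | [set: G] `<=` (fun g => K (x ^ g))].
    have /compact_near_coveringP/(_ G (nbhs 1) (fun x g => K (x ^ g))) := cG.
    apply => g _; have conj_cvg : (fun p : G * G => p.2 ^ p.1) @ (g, 1) --> 1 ^ g.
      apply: mulg_cvg; last by apply: mulg_cvg; [exact: cvg_snd|exact: cvg_fst].
      by apply: continuous_cvg; [exact: invg_continuous|exact: cvg_fst].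
    by apply: conj_cvg; apply: open_nbhs_nbhs; split; rewrite // conj1g; exact: sgrp1.
  by apply: filterS N1 => x Kx g; exact: Kx.
- by move=> x /(_ 1); rewrite conjg1.
Qed.

End TopologicalGroups.

(** * Iterates of an automorphism and subgroups tidy above *)

Section Automorphism.
Variables (G : topologicalGroupType) (T : {multiplicative G -> G}) (S : G -> G).
Hypotheses (TK : cancel T S) (SK : cancel S T).
Local Open Scope group_scope.
Local Notation Tz := (ziter T S).

Lemma ziterM i : {morph Tz i : x y / x * y}.
Proof.
have SM : {morph S : x y / x * y} by exact: can2_gmulfM TK SK.
case: i => n x y /=; first by elim: n => //= n ->; rewrite gmulfM.
by elim: n => [|n IH]; rewrite ?SM //= IH SM.
Qed.

Lemma ziter1 i : Tz i 1 = 1.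
Proof. by apply: (@mulgI _ (Tz i 1)); rewrite -ziterM !mulg1. Qed.

Lemma ziterV i x : Tz i x^-1 = (Tz i x)^-1.
Proof. by apply: (@mulgI _ (Tz i x)); rewrite -ziterM !mulgV ziter1. Qed.

Lemma ziterJ i x g : Tz i (x ^ g) = Tz i x ^ Tz i g.
Proof. by rewrite !conjgE !ziterM ziterV. Qed.

Definition positive_part (V : set G) : set G :=
  [set x | forall k : nat, V (Tz (- k%:Z)%R x)].

Definition negative_part (V : set G) : set G :=
  [set x | forall k : nat, V (Tz k x)].

(** One-step form of V = V_+ V_-: each v is w in V_+ times an element that stays in [V] under one
    application of [T]. For compact open [V], [tidy_above_factor] recovers the full form. *)
Definition tidy_above (V : set G) : Prop :=
  forall v, V v -> exists2 w, positive_part V w & V (T (w^-1 * v)).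

Definition forward_core (N : nat) (V : set G) : set G :=
  [set x | forall k : nat, k <= N -> V (Tz k x)].

Section Parts.
Variable V : set G.
Hypothesis sgV : is_subgroup V.

Lemma positive_part_subgroup : is_subgroup (positive_part V).
Proof.
split=> [k|x y Vx Vy k|x Vx k]; first by rewrite ziter1; exact: sgrp1.
  by rewrite ziterM; exact: sgrpM.
by rewrite ziterV; exact: sgrpV.
Qed.

Lemma negative_part_subgroup : is_subgroup (negative_part V).
Proof.
split=> [k|x y Vx Vy k|x Vx k]; first by rewrite ziter1; exact: sgrp1.
  by rewrite ziterM; exact: sgrpM.
by rewrite ziterV; exact: sgrpV.
Qed.

Lemma forward_core_subgroup N : is_subgroup (forward_core N V).
Proof.
split=> [k _|x y Vx Vy k kN|x Vx k kN]; first by rewrite ziter1; exact: sgrp1.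
  by rewrite ziterM; apply: sgrpM => //; [exact: Vx|exact: Vy].
by rewrite ziterV; apply: sgrpV => //; exact: Vx.
Qed.

Lemma forward_core_normal N : is_normal V -> is_normal (forward_core N V).
Proof. by move=> nV g x Vx k kN; rewrite ziterJ; apply/nV/Vx. Qed.

Lemma forward_core_sub N : forward_core N V `<=` V.
Proof. by move=> x /(_ 0 isT). Qed.

(** Passing from [V] to its forward core leaves the intersection of all translates T^k V unchanged,
    so a coding built from the core has the fibres wanted for [V]. *)
Lemma forward_core_ziter N x :
  (forall i, forward_core N V (Tz i x)) <-> forall i, V (Tz i x).
Proof.
split=> Vx i; first exact: (Vx i 0).
by move=> k _; rewrite -ziterD.
Qed.

End Parts.

Hypothesis cT : continuous T.

Lemma ziter_preimage_open (n : nat) V : open V -> open (Tz n @^-1` V).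
Proof. by move=> oV; apply: open_comp => // x _; exact: ziter_nat_continuous. Qed.

Lemma forward_core_open N V : open V -> open (forward_core N V).
Proof.
move=> oV; elim: N => [|N IH].
  rewrite (_ : forward_core 0 V = V) //; apply/seteqP; split => x.
    exact: forward_core_sub.
  by move=> Vx [|k].
rewrite (_ : forward_core N.+1 V = forward_core N V `&` (Tz N.+1 @^-1` V)).
  by apply: openI => //; exact: ziter_preimage_open.
apply/seteqP; split => x.
  by move=> Vx; split=> [k kN|]; apply: Vx => //; exact: leqW.
by move=> [Vx VNx] k; rewrite leq_eqVlt => /predU1P[->//|]; exact: Vx.
Qed.

Section TidyAbove.
Hypothesis hG : hausdorff_space G.

Lemma ziter_neg_preimage_closed (n : nat) V :
  compact V -> closed (Tz (- n%:Z)%R @^-1` V).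
Proof.
move=> cV; rewrite (_ : _ @^-1` V = Tz n @` V).
  apply: (compact_closed hG); apply: continuous_compact => //.
  exact/continuous_subspaceT/ziter_nat_continuous.
apply/seteqP; split => x.
  by move=> Vx; exists (Tz (- n%:Z)%R x); rewrite ?(ziterNK TK SK).
by move=> [y Vy <-]; rewrite /= (ziterK TK SK).
Qed.

(** The sets [C n] decrease to K_+, which lies in the open set [O] (take w = v), so [C N] meets [K]
    inside [O] for some [N]. For v in the core, T^N v lies there, and pulling its w back by T^-N
    gives the required factor. *)
Lemma tidy_above_forward_core K : is_subgroup K -> open K -> compact K ->
  exists N, tidy_above (forward_core N K).
Proof.
move=> sgK oK cK.
pose C n := [set x | forall k : nat, k <= n -> K (Tz (- k%:Z)%R x)].
pose O := [set v | exists2 w, positive_part K w & K (T (w^-1 * v))].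
have [|n||x Kx Cx|N KCO] := @compact_bigcap_nat_sub _ C K O _ _ cK.
- by move=> m n mn x Cx k km; apply: Cx; exact: leq_trans mn.
- rewrite (_ : C n = \bigcap_(k in [set k : nat | k <= n])
      (Tz (- k%:Z)%R @^-1` K)) //.
  by apply: closed_bigI => k _; exact: ziter_neg_preimage_closed.
- rewrite (_ : O = \bigcup_(w in positive_part K) [set v | K (T (w^-1 * v))]) //.
  apply: bigcup_open => w _; apply: (@open_comp _ _ (fun v => T (w^-1 * v))) => //.
  by move=> x _; apply: continuous_comp; [exact: mulgl_continuous|exact: cT].
- exists x; last by rewrite mulVg -[T 1]/(Tz 1%N 1) ziter1; exact: sgrp1.
  by move=> k; exact: (Cx k).
exists N => v Vv.
have /KCO[w Kw Kwv] : (K `&` C N) (Tz N v).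
  split=> [|k kN]; first exact: Vv.
  by rewrite -(ziterD TK SK) (_ : (- k%:Z + N)%R = (N - k)%N) //; [apply: Vv|]; lia.
exists (Tz (- N%:Z)%R w).
  move=> k j jN; have -> : Tz j (Tz (- k%:Z)%R (Tz (- N%:Z)%R w)) =
      Tz (- (N + k - j)%N%:Z)%R w.
    by rewrite -!(ziterD TK SK); congr (Tz _ w); lia.
  exact: Kw.
move=> j jN.
have -> : Tz j (T ((Tz (- N%:Z)%R w)^-1 * v)) =
    Tz (- (N - j)%N%:Z)%R (T (w^-1 * Tz N v)).
  rewrite !ziter_fun // !ziterM !ziterV -!(ziterD TK SK).
  by congr (T ((Tz _ _)^-1 * Tz _ _)); lia.
(* Only j = N uses the choice of [w]; for smaller j both factors are already in [K]. *)
case: (N - j)%N (leq_subr j N) => [|k kN]; first by [].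
rewrite -[T _]/(Tz 1%N _) -(ziterD TK SK).
have -> : (- k.+1%:Z + 1%N%:Z = - k%:Z)%R by lia.
rewrite ziterM ziterV; apply: sgrpM => //; first exact: sgrpV (Kw k).
rewrite -(ziterD TK SK) (_ : (- k%:Z + N)%R = (N - k)%N) //; [apply: Vv|]; lia.
Qed.

End TidyAbove.
End Automorphism.

(** * Transitivity forces compactness *)

Lemma transitive_iter (X : topologicalType) (f g : X -> X) (U V : set X) x y :
    topologically_transitive f -> open U -> open V -> U x -> V y ->
  exists (n : nat) z, U z /\ V (ziter f g n z).
Proof.
move=> trf oU oV Ux Vy; have [||n [_ [[z Uz <-] Vz]]] := trf _ _ oU oV.
- by exists x.
- by exists y.
by exists n, z.
Qed.

Section TransitiveCompact.
Variables (G : topologicalGroupType) (T : {multiplicative G -> G}) (S : G -> G).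
Hypotheses (TK : cancel T S) (SK : cancel S T).
Hypotheses (cT : continuous T) (hG : hausdorff_space G).
Local Open Scope group_scope.
Local Notation Tz := (ziter T S).

Variable V : set G.
Hypotheses (sgV : is_subgroup V) (oV : open V) (cV : compact V).
Hypothesis tV : tidy_above T S V.
Local Notation Vp := (positive_part T S V).
Local Notation Vm := (negative_part T S V).

Let sgVp : is_subgroup Vp. Proof. exact: positive_part_subgroup. Qed.
Let sgVm : is_subgroup Vm. Proof. exact: negative_part_subgroup. Qed.

Lemma positive_part_ziter (n : nat) x : Vp x -> Vp (Tz (- n%:Z)%R x).
Proof.
move=> Vx k; rewrite -(ziterD TK SK).
by have -> : (- k%:Z - n%:Z = - (k + n)%N%:Z)%R by lia.
Qed.

Lemma positive_part_closed : closed Vp.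
Proof.
rewrite (_ : Vp = \bigcap_(k in [set: nat]) (Tz (- k%:Z)%R @^-1` V)).
  by apply: closed_bigI => k _; exact: ziter_neg_preimage_closed.
by apply/seteqP; split => x Vx k; [move=> _|]; exact: Vx.
Qed.

Lemma positive_part_compact : compact Vp.
Proof.
apply: (subclosed_compact positive_part_closed cV) => x; exact: (@^~ 0).
Qed.

(** Tidiness at T^n (a^-1 x) yields w in V_+; multiplying a by T^-n w gains one more iterate and
    keeps the earlier ones, as T^-i w is in [V] for i >= 0. *)
Lemma tidy_above_factor_nat (n : nat) x : V x ->
  exists2 a, Vp a & forall k : nat, k <= n -> V (Tz k (a^-1 * x)).
Proof.
move=> Vx; elim: n => [|n [a Va Vax]].
  exists 1; first exact: (sgrp1 sgVp).
  by move=> [|//] _; rewrite invg1 mul1g.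
have [w Vw Vwax] := tV (Vax n (leqnn n)).
exists (a * Tz (- n%:Z)%R w).
  by apply: (sgrpM sgVp) => //; exact: positive_part_ziter.
move=> k; rewrite leq_eqVlt ltnS => /predU1P[->|kn].
  rewrite invgM -mulgA ziterM // ziterV // -(ziterD TK SK).
  have -> : (n.+1%:Z - n%:Z = 1%N)%R by lia.
  by rewrite -ziterV // -ziterM // -ziter_fun.
rewrite invgM -mulgA ziterM // ziterV // -(ziterD TK SK).
apply: sgrpM => //; last exact: Vax.
apply: sgrpV => //; have -> : (k%:Z - n%:Z = - (n - k)%N%:Z)%R by lia.
exact: Vw.
Qed.

Lemma tidy_above_factor x : V x -> exists2 a, Vp a & Vm (a^-1 * x).
Proof.
move=> Vx.
pose C (n : nat) := Vp `&` \bigcap_(k in [set k : nat | k <= n])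
  [set a | V (Tz k (a^-1 * x))].
have [||n|a _ Ca] := @compact_bigcap_nat_nonempty _ C V _ _ cV.
- move=> m n mn a [Va Ca]; split => // k km; apply: Ca; exact: leq_trans mn.
- move=> n; apply: closedI; first exact: positive_part_closed.
  apply: closed_bigI => k _; have clV := open_subgroup_closed sgV oV.
  apply: (@closed_comp _ _ (fun a => Tz k (a^-1 * x))) => // a _.
  apply: (@continuous_comp _ _ _ (fun a => a^-1 * x) (Tz k)).
    exact: (continuous_comp (@invg_continuous G a) (@mulgr_continuous G x _)).
  exact: ziter_nat_continuous.
- have [a Va Vax] := tidy_above_factor_nat n Vx.
  by exists a; split; [exact: (Va 0)|].
by exists a => [|k]; [have [] := Ca 0|have [_ /(_ k)] := Ca k; apply => /=].
Qed.

Lemma tidy_above_factorV x : V x -> exists2 b, Vm b & Vp (b^-1 * x).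
Proof.
move=> /(sgrpV sgV)/tidy_above_factor[a Va Vax].
exists (a^-1 * x^-1)^-1; first exact: (sgrpV sgVm).
by rewrite invgK mulgVK; exact: (sgrpV sgVp).
Qed.

Hypothesis trT : topologically_transitive T.

(** Points of T V_+ whose forward orbit stays in [V] from time [N] on. *)
Let B (N : nat) : set G :=
  [set d | Vp (Tz (-1)%R d) /\ forall k : nat, N <= k -> V (Tz k d)].

(** Transitivity gives y in xV with T^n y in [V]. Factoring T^n y = b a over V_- V_+ gives x = T^-n
    b c with c in [V]; factoring c = b' a' the same way, d = T^-n b b' equals x a'^-1, hence stays
    in T V_+. *)
Lemma transitive_expansion x : Vp (Tz (-1)%R x) ->
  exists (N : nat) d, B N d /\ V (d^-1 * x).
Proof.
move=> Vx.
have [n [y [Vxy Vny]]] := transitive_iter S trT (open_coset x oV) oV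
  (cosetxx sgV x) (sgrp1 sgV).
have [b Vb Va] := tidy_above_factorV Vny.
pose c := Tz (- n%:Z)%R (b^-1 * Tz n y) * (x^-1 * y)^-1.
have xE : x = Tz (- n%:Z)%R b * c.
  by rewrite /c ziterM // ziterV // (ziterK TK SK) !gnorm.
have Vc : V c by apply: (sgrpM sgV); [exact: Va|exact: sgrpV].
have [b' Vb' Va'] := tidy_above_factorV Vc.
have dx : (Tz (- n%:Z)%R b * b')^-1 * x = b'^-1 * c by rewrite xE !gnorm.
have dE : Tz (- n%:Z)%R b * b' = x * (b'^-1 * c)^-1.
  by rewrite -dx !gnorm.
exists n, (Tz (- n%:Z)%R b * b'); split; last by rewrite dx; exact: (Va' 0).
split=> [|k nk].
  rewrite dE ziterM // ziterV //; apply: (sgrpM sgVp) => //; apply: (sgrpV sgVp).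
  exact: (@positive_part_ziter 1).
rewrite ziterM // -(ziterD TK SK) (_ : (k%:Z - n%:Z)%R = (k - n)%N); last lia.
by apply: (sgrpM sgV).
Qed.

Lemma transitive_expansion_bounded :
  exists N, forall x, Vp (Tz (-1)%R x) -> exists2 d, B N d & V (d^-1 * x).
Proof.
pose U N := \bigcup_(d in B N) [set x | V (d^-1 * x)].
have [|||x|N BU] := @compact_cover_nat _ U (T @` Vp).
- move=> m n mn x [d [Vd Bd] Vdx]; exists d => //; split => // k nk.
  exact/Bd/(leq_trans mn).
- by move=> n; apply: bigcup_open => d _; exact: open_coset.
- apply: continuous_compact positive_part_compact; exact: continuous_subspaceT.
- move=> [y Vy <-]; have [|N [d [Bd Vd]]] := @transitive_expansion (T y).
    by rewrite /= TK.
  by exists N, d.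
exists N => x Vx; have [|d Bd Vd] := BU x; last by exists d.
by exists (Tz (-1)%R x) => //=; rewrite SK.
Qed.

(* Expanding step by step, the factors contributed beyond step [N] all lie in
   [V]. *)
Lemma transitive_positive_part_bounded :
  exists N : nat, forall (n : nat) x, Vp (Tz (- n%:Z)%R x) ->
    exists2 v, V v & Vp (Tz (- N%:Z)%R (v^-1 * x)).
Proof.
have [N BN] := transitive_expansion_bounded.
exists N => n; have small m x : m <= N -> Vp (Tz (- m%:Z)%R x) ->
    exists2 v, V v & Vp (Tz (- N%:Z)%R (v^-1 * x)).
  move=> mN Vx; exists 1; first exact: sgrp1.
  rewrite invg1 mul1g.
  have -> : (- N%:Z = - (N - m)%N%:Z - m%:Z)%R by lia.
  by rewrite (ziterD TK SK); exact: positive_part_ziter.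
elim: n => [|n IH] x; first exact: small.
have [nN|Nn] := leqP n.+1 N; first exact: small.
have nE : (- n.+1%:Z = -1 - n%:Z)%R by lia.
(* The expansion is applied to T^-n x, a point of T V_+. Since n >= N, T^n d is in [V], and the
   remaining factor lies in T^n V_+, where the induction hypothesis applies. *)
rewrite nE (ziterD TK SK) => Vx; have [d [Vd Bd] Vdx] := BN _ Vx.
have [|v Vv Vvx] := IH (Tz n d^-1 * x).
  rewrite ziterM // (ziterK TK SK) => k.
  case: k => [//|k]; have -> : (- k.+1%:Z = - k%:Z - 1)%R by lia.
  rewrite (ziterD TK SK) ziterM // ziterV //.
  by apply: (sgrpM sgVp); [exact: (sgrpV sgVp)|].
exists (Tz n d * v); first by apply: (sgrpM sgV) => //; exact: Bd.
by move: Vvx; rewrite ziterV // invgM mulgA.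
Qed.

Lemma tidy_transitive_compact : compact [set: G].
Proof.
have [N VN] := transitive_positive_part_bounded.
suff -> : [set: G] = (fun p : G * G => p.1 * p.2) @`
    ((fun p : G * G => p.1 * p.2) @` (V `*` (Tz N @` V)) `*` V).
  have cM K L : compact K -> compact L ->
      compact ((fun p : G * G => p.1 * p.2) @` (K `*` L)).
    move=> cK cL; apply: continuous_compact; last exact: compact_setX.
    exact/continuous_subspaceT/mulg_continuous.
  apply: (cM) => //; apply: (cM) => //; apply: continuous_compact => //.
  exact/continuous_subspaceT/ziter_nat_continuous.
apply/seteqP; split => // g _.
have [n [x [Vx Vnx]]] := transitive_iter S trT oV (open_coset g oV)
  (sgrp1 sgV) (cosetxx sgV g).
(* With x = a b, T^n b stays in [V] and T^n a is in V (T^N V), so T^n x, and then g in (T^n x) V,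
   lies in V (T^N V) V. *)
have [a Va Vb] := tidy_above_factor Vx.
have [|v Vv Vvx] := VN n (Tz n a); first by rewrite (ziterK TK SK).
exists (Tz n a, Tz n (a^-1 * x) * (g^-1 * Tz n x)^-1); last first.
  rewrite -[LHS]/(Tz n a * (Tz n (a^-1 * x) * (g^-1 * Tz n x)^-1)).
  by rewrite ziterM // ziterV // !gnorm.
split; last by apply: (sgrpM sgV); [exact: Vb|exact: sgrpV].
exists (v, v^-1 * Tz n a); last by rewrite /= mulVKg.
split=> //; exists (Tz (- N%:Z)%R (v^-1 * Tz n a)); first exact: (Vvx 0).
by rewrite (ziterNK TK SK).
Qed.

End TransitiveCompact.

(** * Symbolic coding modulo an open normal subgroup *)

Lemma continuous_prod_topology (X : topologicalType) (I : Type)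
    (Y : I -> topologicalType) (f : X -> prod_topology Y) :
  (forall i, continuous (fun x => f x i)) -> continuous f.
Proof.
move=> cf x; apply/cvg_sup => i.
exact: (@continuous_comp_initial _ _ _ (fun y : forall i, Y i => y i) f (cf i)).
Qed.

Section Transversal.
Variables (G : topologicalGroupType) (V : set G).
Hypotheses (cG : compact [set: G]) (sgV : is_subgroup V) (oV : open V).
Local Open Scope group_scope.

(** [coset_repr V] is locally constant, so the complements of preimages of finite sets form a
    directed family of closed sets with empty intersection; compactness makes one of them empty. *)
Lemma finite_coset_repr : finite_set (range (coset_repr V)).
Proof.
pose D := [set ~` (coset_repr V @^-1` B) | B in @finite_set G].
have [||||||_ [B finB <-] DB] := @compact_bigcap_sub G D [set: G] set0.
- by exists (~` (coset_repr V @^-1` set0)); exists set0 => //; exact: finite_set0.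
- move=> _ _ [A finA <-] [B finB <-]; exists (~` (coset_repr V @^-1` (A `|` B))).
    by exists (A `|` B) => //; rewrite /mkset finite_setU.
  by move=> x; rewrite preimage_setU setCU.
- move=> _ [B _ <-]; apply: open_closedC; rewrite openE => x Bx.
  rewrite /interior nbhsE; exists [set y | V (x^-1 * y)].
    by split; [exact: open_coset|exact: cosetxx].
  by move=> y /= Vxy; rewrite /= -(eq_coset_repr sgV Vxy).
- exact: cG.
- exact: open0.
- move=> x _ /(_ (~` (coset_repr V @^-1` [set coset_repr V x]))) []//.
  by exists [set coset_repr V x] => //; exact: finite_set1.
apply: sub_finite_set finB => _ [x _ <-]; apply: contrapT => nBx.
by apply: (DB x).
Qed.

(** Supplies the alphabet of the coding, with Q = TV . V. *)
Lemma finite_transversal (Q : set G) :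
    (forall x y, Q x -> V (x^-1 * y) -> Q y) ->
  exists (A : finType) (q : A -> G),
    [/\ forall a, Q (q a), forall g, Q g -> exists a, V ((q a)^-1 * g)
      & forall a b, V ((q a)^-1 * q b) -> a = b].
Proof.
move=> QV; pose R := coset_repr V @` Q.
have finR : finite_set R.
  by apply: sub_finite_set finite_coset_repr; exact: image_subset.
pose A := fset_set R; have AR (a : A) : R (val a).
  by have := fsvalP a; rewrite in_fset_set // => /set_mem.
exists A, val; split=> [a|g Qg|a b Vab].
- by have [x Qx <-] := AR a; apply: QV Qx _; exact: coset_reprP.
- have gA : coset_repr V g \in A by rewrite in_fset_set //; apply/mem_set; exists g.
  by exists [` gA]%fset; apply: (coset_sym sgV); exact: coset_reprP.
- apply: val_inj; have [x _ xa] := AR a; have [y _ yb] := AR b.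
  rewrite -xa -yb; apply: (eq_coset_repr sgV).
  apply: (coset_trans sgV (coset_reprP x sgV)); rewrite xa.
  apply: (coset_trans sgV Vab); rewrite -yb.
  by apply: (coset_sym sgV); exact: coset_reprP.
Qed.

End Transversal.

Lemma transpose_normal (G : groupType) (H : set G) (x y : G) :
  is_normal H -> H (x^-1 * y)%g -> H (y * x^-1)%g.
Proof. by move=> nH /(nH x^-1)%g; rewrite conjgE !gnorm. Qed.

Section Coding.
Variables (G : topologicalGroupType) (T : {multiplicative G -> G}) (S : G -> G).
Hypotheses (TK : cancel T S) (SK : cancel S T).
Hypotheses (cT : continuous T) (cS : continuous S) (cG : compact [set: G]).
Hypothesis trT : topologically_transitive T.
Local Open Scope group_scope.
Local Notation Tz := (ziter T S).

Variable V : set G.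
Hypotheses (sgV : is_subgroup V) (nV : is_normal V) (oV : open V).
Hypothesis tV : tidy_above T S V.

(** The product T^i V . V. The increasing subgroups P_j are [PV (- j)], and labels live in [PV 1]
    modulo [V]. *)
Definition translate_mul (i : int) : set G :=
  [set x | exists2 v, V v & V ((Tz i v)^-1 * x)].
Local Notation PV := translate_mul.

Lemma translate_mul_sub i x : V x -> PV i x.
Proof. by move=> Vx; exists 1; rewrite ?ziter1 ?invg1 ?mul1g //; exact: sgrp1. Qed.

Lemma translate_mul_ziter i x : V x -> PV i (Tz i x).
Proof. by move=> Vx; exists x => //; exact: cosetxx. Qed.

Lemma translate_mul_subgroup i : is_subgroup (PV i).
Proof.
split=> [|x y [v Vv Vx] [w Vw Vy]|x [v Vv Vx]].
- by apply: translate_mul_sub; exact: sgrp1.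
- exists (v * w); first exact: sgrpM.
  by rewrite ziterM //; exact: cosetMM.
- exists v^-1; first exact: sgrpV.
  rewrite ziterV // invgK -[X in X * _]invgK -invgM; apply: sgrpV => //.
  exact: transpose_normal.
Qed.

Lemma translate_mul_normal i : is_normal (PV i).
Proof.
move=> g x [v Vv Vx]; exists (v ^ Tz (- i)%R g); first exact: nV.
by rewrite ziterJ // (ziterNK TK SK) -conjVg -conjMg; exact: nV.
Qed.

Lemma translate_mul0 x : PV 0 x -> V x.
Proof. by move=> [v Vv Vx]; rewrite -(mulVKg v x); exact: sgrpM. Qed.

Lemma translate_mul_open i : open (PV i).
Proof.
apply: subgroup_nbhs1_open (translate_mul_subgroup i) _.
apply: filterS (@translate_mul_sub i) _.
by apply: open_nbhs_nbhs; split => //; exact: sgrp1.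
Qed.

(** Write v = w (w^-1 v) by tidiness: T^-j w is in [V], and T^-j (w^-1 v) is T^-(j+1) of an element
    of [V]. *)
Lemma translate_mul_leS (j : nat) : PV (- j%:Z)%R `<=` PV (- j.+1%:Z)%R.
Proof.
move=> x [v Vv Vx]; have [w Vw Vwv] := tV Vv.
have sgP := translate_mul_subgroup (- j.+1%:Z)%R.
rewrite -(mulVKg (Tz (- j%:Z)%R v) x); apply: (sgrpM sgP); last exact: translate_mul_sub.
rewrite -(mulVKg w v) ziterM //; apply: (sgrpM sgP).
  exact/translate_mul_sub/Vw.
have -> : Tz (- j%:Z)%R (w^-1 * v) = Tz (- j.+1%:Z)%R (T (w^-1 * v)).
  rewrite -[T _]/(Tz 1%N _) -(ziterD TK SK).
  by have -> : (- j.+1%:Z + 1%N%:Z = - j%:Z)%R by lia.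
exact: translate_mul_ziter.
Qed.

Lemma translate_mul_le (m n : nat) : m <= n -> PV (- m%:Z)%R `<=` PV (- n%:Z)%R.
Proof.
move=> /subnK <-; elim: (n - m)%N => [|k IH] //.
by apply: subset_trans IH _; exact: translate_mul_leS.
Qed.

Lemma translate_mul_full : exists m : nat, forall x, PV (- m%:Z)%R x.
Proof.
have [|n|x _|m PVm] :=
  @compact_cover_nat G (fun n : nat => PV (- n%:Z)%R) [set: G] _ _ cG.
- exact: translate_mul_le.
- exact: translate_mul_open.
- have [n [z [Vxz Vnz]]] := transitive_iter S trT (open_coset x oV) oV
    (cosetxx sgV x) (sgrp1 sgV).
  exists n; have sgP := translate_mul_subgroup (- n%:Z)%R.
  rewrite -[x](mulgVK (x^-1 * z)^-1) invgK mulVKg.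
  apply: (sgrpM sgP); last by apply: translate_mul_sub; exact: sgrpV.
  by rewrite -(ziterK TK SK n z); exact: translate_mul_ziter.
by exists m => x; exact: PVm.
Qed.

Lemma translate_mul_image (j : nat) x : PV (- j.+1%:Z)%R x ->
  exists2 p, PV (- j%:Z)%R p & PV 1 (p^-1 * T x).
Proof.
move=> [v Vv Vx]; exists (Tz (- j%:Z)%R v); first exact: translate_mul_ziter.
have -> : (Tz (- j%:Z)%R v)^-1 * T x = Tz 1 ((Tz (- j.+1%:Z)%R v)^-1 * x).
  rewrite ziterM // ziterV // -(ziterD TK SK).
  by have -> : (1 - j.+1%:Z = - j%:Z)%R by lia.
exact: translate_mul_ziter.
Qed.

(* [f x] is a successor of [x] up to [T^-j V . V]; the refinement from [j.+1]
   to [j] picks it inside the coset already chosen. *)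
Definition coherent_successor (j : nat) (f : G -> G) : Prop :=
  [/\ forall x y, PV (- j.+1%:Z)%R (x^-1 * y) -> f x = f y,
      forall x, exists2 q, PV 1 q & PV (- j%:Z)%R ((T x * q)^-1 * f x)
    & forall (i : nat) x y, j <= i -> PV (- i.+1%:Z)%R (x^-1 * y) ->
        PV (- i%:Z)%R ((f x)^-1 * f y)].

(** With r x a representative modulo P_(j+1), the new successor of x is T (r x) t (r x), where t in
    TV . V is chosen to agree with f modulo P_(j+1). It is constant on cosets of P_(j+1), which
    settles level j, and inherits the higher levels from f. *)
Lemma coherent_successor_refine j f :
  coherent_successor j.+1 f -> exists f', coherent_successor j f'.
Proof.
move=> [fc fT fP]; pose r := coset_repr (PV (- j.+1%:Z)%R).
have sg i := translate_mul_subgroup i.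
have /choice[t tP] : forall g, exists q, PV 1 q /\
    PV (- j.+1%:Z)%R ((T g * q)^-1 * f g).
  by move=> g; have [q Qq Pq] := fT g; exists q.
have rx x : PV (- j.+1%:Z)%R (x^-1 * r x) by exact: coset_reprP.
have rE x y : PV (- j.+1%:Z)%R (x^-1 * y) -> r x = r y by exact: eq_coset_repr.
exists (fun x => T (r x) * t (r x)); split=> [x y /rE->//|x|i x y].
- have [p Pp Qp] := translate_mul_image (rx x).
  (* Replacing x by r x costs T (x^-1 r x), which is p in P_j times an element of TV . V; [q]
     absorbs the latter, and the error left is the conjugate of p by q. *)
  pose q := p^-1 * T (x^-1 * r x) * t (r x); exists q.
    by apply: (sgrpM (sg _)) => //; have [] := tP (r x).
  have -> : (T x * q)^-1 * (T (r x) * t (r x)) = p ^ q.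
    rewrite /q !conjgE -[T x]/(Tz 1%N x) -[T (_ * _)]/(Tz 1%N _) ziterM // ziterV //.
    by rewrite !gnorm.
  exact: translate_mul_normal.
- rewrite leq_eqVlt => /predU1P[<- /rE->|ji Pxy]; first exact: cosetxx.
  have toi := @translate_mul_le _ _ ji.
  have toi1 := @translate_mul_le _ _ (leqW ji).
  have Prxy : PV (- i.+1%:Z)%R ((r x)^-1 * r y).
    apply: (coset_trans (sg _) _ (coset_trans (sg _) Pxy _)).
      by apply: coset_sym => //; exact/toi1/rx.
    exact/toi1/rx.
  apply: (coset_trans (sg _) _ (coset_trans (sg _) (fP i _ _ ji Prxy) _)).
    by apply: toi; have [] := tP (r x).
  by apply: coset_sym => //; apply: toi; have [] := tP (r y).
Qed.

Lemma coherent_successor_exists : exists f, coherent_successor 0 f.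
Proof.
have [m PVm] := translate_mul_full.
have sg i := translate_mul_subgroup i.
suff base n : n <= m -> exists f, coherent_successor (m - n) f.
  by have := base m (leqnn m); rewrite subnn.
elim: n => [|n IH] nm.
  (* At level m, P_m = G and congruence modulo P_m is no constraint, so a constant works. *)
  rewrite subn0; exists (fun=> 1); split=> // [x|i x y _ _].
    by exists 1; [exact: sgrp1|exact: PVm].
  exact: cosetxx.
have [f] := IH (ltnW nm).
have -> : (m - n = (m - n.+1).+1)%N by lia.
exact: coherent_successor_refine.
Qed.

Section Labels.
Variables (f : G -> G) (A : finType) (q : A -> G) (a : G -> A).
Hypothesis fP : coherent_successor 0 f.
Hypothesis q_sub : forall b, PV 1 (q b).
Hypothesis q_inj : forall b c, V ((q b)^-1 * q c) -> b = c.
Hypothesis aP : forall g, V ((q (a g))^-1 * ((f g)^-1 * T g)).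

Let sg i : is_subgroup (PV i). Proof. exact: translate_mul_subgroup. Qed.

Lemma label_decomp g : V ((f g * q (a g))^-1 * T g).
Proof. by rewrite invgM -mulgA. Qed.

(** Coherence puts f g and f h in one coset of P_j, and T g, T h differ from them by the same letter
    modulo [V]. Each common label thus improves congruence by one level. *)
Lemma label_contract (j : nat) g h : a g = a h ->
  PV (- j.+1%:Z)%R (g^-1 * h) -> PV (- j%:Z)%R ((T g)^-1 * T h).
Proof.
move=> agh Pgh; have [_ _ /(_ j g h isT Pgh) Pfgh] := fP.
have Vg := translate_mul_sub (- j%:Z)%R (label_decomp g).
have Vh := translate_mul_sub (- j%:Z)%R (label_decomp h).
apply: (coset_trans (sg _) (coset_sym (sg _) Vg)).
apply: (coset_trans (sg _) _ Vh); rewrite -agh.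
apply: cosetMM => //; [exact: translate_mul_normal|exact: cosetxx].
Qed.

(** [f] is constant on cosets of P_1, hence on those of [V], so the cosets of g and T g modulo [V]
    determine the letter. *)
Lemma label_local g h : V (g^-1 * h) -> V ((T g)^-1 * T h) -> a g = a h.
Proof.
move=> Vgh VTgh; apply: q_inj; have [fc _ _] := fP.
have fgh : f g = f h by apply: fc; exact: translate_mul_sub.
have := coset_trans sgV (label_decomp g) (coset_trans sgV VTgh
  (coset_sym sgV (label_decomp h))).
by rewrite fgh invgM -mulgA mulKg.
Qed.

Lemma label_near i x : \forall y \near x, a (Tz i y) = a (Tz i x).
Proof.
have cz j : nbhs x [set y | V (Tz j (x^-1 * y))].
  have /open_nbhs_nbhs : open_nbhs x [set y | V (Tz j (x^-1 * y))] => //.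
  split; last by rewrite /= mulVg ziter1 //; exact: sgrp1.
  apply: (@open_comp _ _ (fun y => Tz j (x^-1 * y))) => // y _.
  apply: (@continuous_comp _ _ _ (fun y => x^-1 * y) (Tz j)).
    exact: mulgl_continuous.
  exact: ziter_continuous.
apply: filterS (filterI (cz i) (cz (1 + i)%R)) => y [/= Vi Vi1].
apply/esym/label_local; first by rewrite -ziterV // -ziterM.
by rewrite -[T _]/(Tz 1%N _) -[T (Tz i y)]/(Tz 1%N _) -!(ziterD TK SK) -ziterV // -ziterM.
Qed.

Definition itinerary (x : G) : full_shift A := fun i => a (Tz i x).

Lemma itinerary_shift x : itinerary (T x) = shift (itinerary x).
Proof.
by apply: funext => i; rewrite /shift /itinerary (ziterD TK SK).
Qed.

Lemma itinerary_continuous : continuous itinerary.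
Proof.
apply: continuous_prod_topology => i x; apply: near_cst_continuous.
exact: label_near.
Qed.

Lemma itinerary_fiber x y :
  itinerary x = itinerary y <-> forall i, V (Tz i (x^-1 * y)).
Proof.
split=> [xy|Vxy].
  have [m PVm] := translate_mul_full.
  (* Start from P_m = G and use the n labels preceding time i to descend n levels; n = m reaches P_0
     = V. *)
  suff contr n i : n <= m -> PV (- (m - n)%N%:Z)%R (Tz i (x^-1 * y)).
    by move=> i; apply: translate_mul0; have := contr m i (leqnn m); rewrite subnn.
  elim: n i => [|n IH] i nm; first by rewrite subn0.
  have := IH (i - 1)%R (ltnW nm); have -> : (m - n = (m - n.+1).+1)%N by lia.
  rewrite ziterM // ziterV // => /label_contract.
  have -> : a (Tz (i - 1)%R x) = a (Tz (i - 1)%R y) by exact: (congr1 (@^~ (i - 1)%R) xy).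
  by rewrite -!ziterS // GRing.subrK -ziterV // -ziterM //; apply.
apply: funext => i; apply: label_local; first by rewrite -ziterV // -ziterM.
by rewrite -!ziterS // -ziterV // -ziterM.
Qed.

(** Multiplying x by T^-n w with w in V_+ preserves the cosets of T^k x modulo [V] for k <= n, hence
    the labels before n. Tidiness lets T w reach any class of TV . V modulo [V], so the label at n
    can be prescribed. *)
Lemma itinerary_prefix (b : nat -> A) n :
  exists x, forall k : nat, k < n -> a (Tz k x) = b k.
Proof.
elim: n => [|n [x xb]]; first by exists 1.
have [_ fT _] := fP; set g := Tz n x.
have [p Qp /translate_mul0 Vp] := fT g.
have [v Vv Vvq] : PV 1 ((T g)^-1 * (f g * q (b n))).
  have -> : (T g)^-1 * (f g * q (b n)) = p * ((T g * p)^-1 * f g) * q (b n).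
    by rewrite !gnorm.
  by do 2![apply: (sgrpM (sg _)) => //]; exact: translate_mul_sub.
have [w Vw Vwv] := tV Vv.
have Twv : V ((T w)^-1 * T v).
  by move: Vwv; rewrite -[T _]/(Tz 1%N _) ziterM // ziterV.
have xu (k : nat) : k <= n -> V ((Tz k x)^-1 * Tz k (x * Tz (- n%:Z)%R w)).
  move=> kn; rewrite ziterM // mulKg -(ziterD TK SK).
  by have -> : (k%:Z - n%:Z = - (n - k)%N%:Z)%R by lia.
exists (x * Tz (- n%:Z)%R w) => k; rewrite ltnS leq_eqVlt => /predU1P[->|kn].
  have Vgu : V (g^-1 * Tz n (x * Tz (- n%:Z)%R w)) by exact: xu.
  set u := Tz n _ in Vgu *.
  have uE : u = g * w by rewrite /u ziterM // (ziterNK TK SK).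
  apply: q_inj; have [fc _ _] := fP.
  have fgu : f g = f u by apply: fc; exact: translate_mul_sub.
  have Tu : V ((T u)^-1 * (f u * q (b n))).
    rewrite -fgu uE -[T _]/(Tz 1%N _) ziterM // invgM -mulgA.
    exact: (coset_trans sgV Twv Vvq).
  have := coset_trans sgV (label_decomp u) Tu.
  by rewrite invgM -mulgA mulKg.
rewrite -xb //; apply/esym/label_local; first exact/xu/ltnW.
exact: (xu k.+1).
Qed.

Lemma itinerary_surj b : exists x, itinerary x = b.
Proof.
pose C (n : nat) := \bigcap_(i in [set i : int | (`|i| <= n)%N])
  [set x | a (Tz i x) = b i].
have [||n|x _ Cx] := @compact_bigcap_nat_nonempty G C [set: G] _ _ cG.
- by move=> m n mn x Cx i im; apply: Cx; exact: leq_trans mn.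
- move=> n; apply: closed_bigI => i _; rewrite -[X in closed X]setCK.
  apply: open_closedC; rewrite openE => x /= nx; rewrite /interior.
  by apply: filterS (label_near i x) => y /= ->.
(* The window from -n to n has 2n + 1 places; it is shifted by n to start at 0. *)
- have [x xb] := itinerary_prefix (fun k => b (k%:Z - n%:Z)%R) (n + n).+1.
  exists (Tz n x); split => // i ni; rewrite /mkset -(ziterD TK SK).
  have -> : (i + n%:Z = `|(i + n%:Z)%R|%N%:Z)%R by move: ni => /=; lia.
  rewrite xb; last by move: ni => /=; lia.
  by congr b; move: ni => /=; lia.
by exists x; apply: funext => i; apply: (Cx `|i|%N) => /=.
Qed.

End Labels.

Lemma transitive_tidy_coding : exists (A : finType) (phi : G -> full_shift A),
  [/\ continuous phi, forall y, exists x, phi x = y,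
      forall x, phi (T x) = shift (phi x)
    & forall x y, phi x = phi y <-> forall i, V (Tz i (x^-1 * y))].
Proof.
have [f fP] := coherent_successor_exists.
have sg i := translate_mul_subgroup i.
have [|A [q [qQ qV q_inj]]] := @finite_transversal G V cG sgV oV (PV 1).
  move=> x y Qx Vxy; rewrite -(mulVKg x y); apply: (sgrpM (sg _)) => //.
  exact: translate_mul_sub.
have /choice[a aP] : forall g, exists b, V ((q b)^-1 * ((f g)^-1 * T g)).
  move=> g; apply: qV; have [_ /(_ g)[p Qp /translate_mul0 Vp] _] := fP.
  have -> : (f g)^-1 * T g = (p * ((T g * p)^-1 * f g))^-1 by rewrite !gnorm.
  apply/(sgrpV (sg _))/(sgrpM (sg _)) => //; exact: translate_mul_sub.
exists A, (itinerary a); split.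
- exact: (itinerary_continuous fP q_inj aP).
- exact: (itinerary_surj fP qQ q_inj aP).
- exact: itinerary_shift.
- exact: (itinerary_fiber fP q_inj aP).
Qed.

End Coding.

Lemma transitive_coding (G : topologicalGroupType) (T : {multiplicative G -> G})
    (S : G -> G) (K : set G) :
    cancel T S -> cancel S T -> continuous T -> continuous S ->
    hausdorff_space G -> compact [set: G] -> topologically_transitive T ->
    is_subgroup K -> is_normal K -> open K ->
  exists (A : finType) (phi : G -> full_shift A),
    [/\ continuous phi, forall y, exists x, phi x = y,
        forall x, phi (T x) = shift (phi x)
      & forall x y, phi x = phi y <-> forall i, K (ziter T S i (x^-1 * y)%g)].
Proof.
move=> TK SK cT cS hG cG trT sgK nK oK.
have cK : compact K.
  exact: subclosed_compact (open_subgroup_closed sgK oK) cG (@subsetT _ K).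
have [N tN] := tidy_above_forward_core TK SK cT hG sgK oK cK.
have [A [phi [cphi phi_surj phiT phiK]]] := transitive_tidy_coding TK SK cT cS cG trT
  (forward_core_subgroup TK SK sgK N) (@forward_core_normal _ _ _ TK SK _ N nK)
  (@forward_core_open _ _ S cT N _ oK) tN.
exists A, phi; split => // x y; rewrite phiK.
exact: forward_core_ziter.
Qed.

(** * From compatible codings to an inverse limit *)

Lemma full_shift_hausdorff (A : finType) : hausdorff_space (full_shift A).
Proof. by apply: hausdorff_product => i; exact: discrete_hausdorff. Qed.

Lemma inverse_limit_hausdorff (X : nat -> topologicalType)
    (f : forall n, X n.+1 -> X n) :
  (forall n, hausdorff_space (X n)) -> hausdorff_space (inverse_limit f).
Proof.
move=> hX; apply: (@injective_continuous_hausdorff _ (prod_topology X) set_val).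
- exact: val_inj.
- exact: initial_continuous.
- exact: hausdorff_product.
Qed.

Lemma conjugate_shift_limit (G : topologicalType) (T : G -> G)
    (A : nat -> finType) (phi : forall n, G -> full_shift (A n)) :
    compact [set: G] -> (forall n, continuous (phi n)) ->
    (forall n y, exists x, phi n x = y) ->
    (forall n x, phi n (T x) = shift (phi n x)) ->
    (forall n x y, phi n.+1 x = phi n.+1 y -> phi n x = phi n y) ->
    (forall x y, (forall n, phi n x = phi n y) -> x = y) ->
  exists S : full_shift_system, topologically_conjugate T (@shift_limit_map S).
Proof.
move=> cG cphi phi_surj phiT phi_le phi_inj.
pose s n := projT1 (choice (phi_surj n)).
have sP n : cancel (s n) (phi n) := projT2 (choice (phi_surj n)).
(* The section [s] need not be continuous: [b n] is the factorisation of [phi n] through [phi n.+1],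
   independent of the section, and its continuity comes from compactness. *)
pose b n (y : full_shift (A n.+1)) : full_shift (A n) := phi n (s n.+1 y).
have bE n x : b n (phi n.+1 x) = phi n x by apply: phi_le; rewrite sP.
have bc n : continuous (b n).
  apply: (compact_surj_continuous cG (@full_shift_hausdorff _) (cphi n.+1)) => //.
  by have -> : b n \o phi n.+1 = phi n by apply: funext => x; exact: bE.
have b_surj n y : exists x, b n x = y.
  by have [x <-] := phi_surj n y; exists (phi n.+1 x).
have bS n y : b n (shift y) = shift (b n y).
  by have [x <-] := phi_surj _ y; rewrite -phiT !bE phiT.
exists (FullShiftSystem bc b_surj bS).
have hL x : (fun n => phi n x) \in inverse_limit_set b by apply/mem_set => n; exact: bE.
pose h x : inverse_limit b := exist _ (fun n => phi n x) (hL x).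
have h_inj : injective h.
  by move=> x y /(congr1 val) /= xy; apply: phi_inj => n; exact: (congr1 (@^~ n) xy).
have h_surj y : exists x, h x = y.
  (* Compatibility of [y] makes these nonempty closed fibres decrease, so a common point exists. *)
  pose C n := phi n @^-1` [set val y n].
  have yE n : b n (val y n.+1) = val y n by exact: (set_mem (valP y) n).
  have Cdecr n : C n.+1 `<=` C n by move=> x /= Cx; rewrite /C /= -yE -Cx bE.
  have [||n|x _ Cx] := @compact_bigcap_nat_nonempty _ C [set: G] _ _ cG.
  - move=> m n /subnK <-; elim: (n - m)%N => [|k IH] //.
    by apply: subset_trans IH; exact: Cdecr.
  - move=> n; apply: closed_comp => [x _|]; first exact: cphi.
    apply: (accessible_closed_set1 (hausdorff_accessible _)).
    exact: full_shift_hausdorff.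
  - by have [x xy] := phi_surj n (val y n); exists x.
  by exists x; apply: val_inj; apply: functional_extensionality_dep => n; exact: Cx.
have hc : continuous h.
  apply: continuous_comp_initial; exact: continuous_prod_topology.
have [g gK] := choice h_surj.
exists h; last first.
  move=> x; apply: val_inj; apply: functional_extensionality_dep => n.
  exact: phiT.
have hK : cancel h g by move=> x; apply: h_inj; rewrite gK.
exists g; split=> //; apply: (compact_surj_continuous cG _ hc h_surj).
  by apply: inverse_limit_hausdorff => n; exact: full_shift_hausdorff.
have -> : g \o h = id by apply: funext => x; exact: hK.
by move=> x; exact: cvg_id.
Qed.

(** * Small open subgroups and open normal subgroups *)

Section OpenNormalSubgroups.
Variable G : topologicalGroupType.
Hypotheses (hG : hausdorff_space G) (tdG : totally_disconnected [set: G]).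
Local Open Scope group_scope.

(** Van Dantzig's theorem. *)
Lemma compact_open_subgroup_nbhs (W : set G) :
    locally_compact [set: G] -> nbhs 1 W ->
  exists K, [/\ is_subgroup K, open K, compact K & K `<=` W].
Proof.
move=> lcG W1; have [C] := lcG 1 I; rewrite withinET => C1 [cC _].
have [U [oU cU U1 UW]] := totally_disconnected_compact_open_nbhs hG tdG cC C1 W1.
have [K [sgK oK cK KU]] := compact_open_subgroup_sub cU oU U1.
by exists K; split => //; exact: subset_trans UW.
Qed.

Hypothesis cG : compact [set: G].

Lemma open_normal_subgroup_nbhs (W : set G) : nbhs 1 W ->
  exists N, [/\ is_subgroup N, is_normal N, open N & N `<=` W].
Proof.
move=> W1; have [U [oU cU U1 UW]] :=
  totally_disconnected_compact_open_nbhs hG tdG cG (@filterT _ (nbhs (1 : G)) _) W1.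
have [K [sgK oK _ KU]] := compact_open_subgroup_sub cU oU U1.
have [N [sgN nN oN NK]] := open_normal_core cG sgK oK.
by exists N; split => //; apply: subset_trans NK _; exact: subset_trans UW.
Qed.

Lemma open_normal_subgroup_sequence : @second_countable G ->
  exists K : nat -> set G,
    [/\ forall n, [/\ is_subgroup (K n), is_normal (K n) & open (K n)],
        forall n, K n.+1 `<=` K n & forall x, (forall n, K n x) -> x = 1].
Proof.
move=> [B /countable_injP[f] finj [Bop Bbase]].
(* [g] enumerates the base by inverting [f], with default [setT] off its range. Each base set around
   1 contains its own [N], so the Hausdorff property makes the intersection trivial. *)
have /choice[g gP] : forall n : nat, exists b, forall b', B b' -> f b' = n -> b = b'.
  move=> n; have [[b [Bb fb]]|nb] := pselect (exists b, B b /\ f b = n).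
    by exists b => b' Bb' fb'; apply: finj; [exact: mem_set|exact: mem_set|rewrite fb].
  by exists setT => b' Bb' fb'; case: nb; exists b'.
have /choice[N NP] : forall W : set G, exists N,
    [/\ is_subgroup N, is_normal N & open N] /\ (nbhs 1 W -> N `<=` W).
  move=> W; have [/open_normal_subgroup_nbhs[N [sgN nN oN NW]]|nW] := pselect (nbhs 1 W).
    by exists N.
  by exists setT; split => //; split => //; exact: openT.
pose K n := [set x | forall i, i <= n -> N (g i) x].
have sgN i : is_subgroup (N (g i)) by have [[]] := NP (g i).
have nN i : is_normal (N (g i)) by have [[]] := NP (g i).
have KS n : K n.+1 = K n `&` N (g n.+1).
  apply/seteqP; split => x.
    by move=> Kx; split=> [i i_n|]; apply: Kx => //; exact: leqW.
  by move=> [Kx Nx] i; rewrite leq_eqVlt => /predU1P[->//|]; exact: Kx.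
exists K; split=> [n|n|x Kx].
- split.
  + split=> [i _|x y Kx Ky i i_n|x Kx i i_n].
    * exact: sgrp1.
    * by apply: sgrpM => //; [exact: Kx|exact: Ky].
    * by apply: sgrpV => //; exact: Kx.
  + by move=> h x Kx i i_n; apply/nN/Kx.
  + elim: n => [|n IH].
      have -> : K 0 = N (g 0); last by have [[]] := NP (g 0).
      apply/seteqP; split=> x; first by move=> /(_ 0 isT).
      by move=> Nx [|i].
    by rewrite KS; apply: openI => //; have [[]] := NP (g n.+1).
- by rewrite KS => x [].
- apply: contrapT => x1; have cl1 : closed [set x].
    exact/accessible_closed_set1/hausdorff_accessible.
  have [|b [Bb b1] bx] := Bbase 1 (~` [set x]).
    by apply: open_nbhs_nbhs; split; [exact: closed_openC|move=> /= /esym].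
  have gb : g (f b) = b by exact: gP.
  have [_ Nb] := NP (g (f b)); apply: (bx x) => //.
  have b1' : nbhs 1 b by apply: open_nbhs_nbhs; split => //; exact: Bop.
  by rewrite gb in Nb; apply: (Nb b1'); rewrite -gb; exact: (Kx (f b)).
Qed.

End OpenNormalSubgroups.

Theorem mainTheorem4 (G : topologicalGroupType)
    (G_second_countable : @second_countable G)
    (G_hausdorff : hausdorff_space G)
    (G_locally_compact : locally_compact [set: G])
    (G_totally_disconnected : totally_disconnected [set: G])
    (T : {multiplicative G -> G})
    (T_bijective : bijective T)
    (T_continuous : continuous T)
    (T_transitive : topologically_transitive T) :
  exists S : full_shift_system,
    topologically_conjugate T (@shift_limit_map S).
Proof.
case: T_bijective => S TK SK.
have cG : compact [set: G].
  have [K [sgK oK cK _]] := compact_open_subgroup_nbhs G_hausdorff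
    G_totally_disconnected G_locally_compact (@filterT _ (nbhs (1%g : G)) _).
  have [N tN] := tidy_above_forward_core TK SK T_continuous G_hausdorff sgK oK cK.
  have sgV := forward_core_subgroup TK SK sgK N.
  have oV := @forward_core_open _ _ S T_continuous N _ oK.
  apply: (tidy_transitive_compact TK SK T_continuous G_hausdorff sgV oV _ tN) => //.
  apply: subclosed_compact (open_subgroup_closed sgV oV) cK _.
  exact: forward_core_sub.
(* A continuous bijection of a compact Hausdorff space has a continuous inverse. *)
have cS : continuous S.
  apply: (compact_surj_continuous cG G_hausdorff T_continuous).
    by move=> y; exists (S y).
  have -> : S \o T = id by apply: funext => x; exact: TK.
  by move=> x; exact: cvg_id.
have [K [KP Kdecr K1]] := open_normal_subgroup_sequence G_hausdorff
  G_totally_disconnected cG G_second_countable.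
(* Alphabet and coding are paired so that one choice selects both at every level. *)
have /choice[c cP] : forall n, exists c : {A : finType & G -> full_shift A},
    [/\ continuous (projT2 c), forall y, exists x, projT2 c x = y,
        forall x, projT2 c (T x) = shift (projT2 c x)
      & forall x y, projT2 c x = projT2 c y <->
          forall i, K n (ziter T S i (x^-1 * y)%g)].
  move=> n; have [sgK nK oK] := KP n.
  have [A [phi phiP]] := transitive_coding TK SK T_continuous cS G_hausdorff cG
    T_transitive sgK nK oK.
  by exists (existT _ A phi).
apply: (@conjugate_shift_limit G T (fun n => projT1 (c n)) (fun n => projT2 (c n))) => //.
- by move=> n; have [] := cP n.
- by move=> n; have [] := cP n.
- by move=> n; have [] := cP n.
- move=> n x y; have [_ _ _ ->] := cP n.+1; have [_ _ _ ->] := cP n.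
  by move=> Kxy i; exact/Kdecr/Kxy.
- move=> x y xy; apply: (@mulgI _ x^-1%g); rewrite mulVg; apply/esym/K1 => n.
  (* Time 0 of the fibre condition puts x^-1 y in every [K n]. *)
  by have [_ _ _ /(_ x y)[/(_ (xy n))/(_ 0%R)]] := cP n.
Qed.
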